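(* For every $z\in kA[[\lambda]]$, $$\exp_*(\log_\diamond(1+\lambda z))=\frac1{1-\lambda z}\quad\text{and}\quad \exp_\star(-\log_\diamond(1+\lambda z))=\frac1{1+\lambda z}.$$
   Context: Let $k$ be a field containing $\mathbb{Q}$, $A$ a countable set of ''letters'', $kA$ the $k$-vector space with basis $A$, and $\diamond$ an associative and commutative $k$-bilinear product on $kA$. Let $k\langle A\rangle$ be the noncommutative polynomial algebra over $A$: the $k$-vector space with basis the words $a_1a_2\cdots a_n$ ($a_i\in A$, $n\ge 0$), with concatenation product; $1$ is the empty word. The $k$-bilinear products $*$ and $\star$ on $k\langle A\rangle$ are defined by requiring $1$ to be the identity element for each and, for all $a,b\in A$ and words $w,v$, $$aw*bv=a(w*bv)+b(aw*v)+(a\diamond b)(w*v),\qquad aw\star bv=a(w\star bv)+b(aw\star v)-(a\diamond b)(w\star v).$$ (Both are commutative and associative.) Let $\lambda$ be a formal parameter; $kA[[\lambda]]$ and $k\langle A\rangle[[\lambda]]$ are the formal power series in $\lambda$ with coefficients in $kA$ and $k\langle A\rangle$, and all products are extended $k[[\lambda]]$-bilinearly (and $\lambda$-adically continuously). The fraction $\frac1{1-u}$, for $u\in\lambda k\langle A\rangle[[\lambda]]$, means $1+u+u^2+\cdots$ with respect to concatenation. For $\bullet\in\{*,\star\}$ and $u\in\lambda k\langle A\rangle[[\lambda]]$, $\exp_\bullet(u)=1+\sum_{i\ge1}\frac{u^{\bullet i}}{i!}$, and for $u\in\lambda kA[[\lambda]]$, $\log_\diamond(1+u)=\sum_{i\ge1}\frac{(-1)^{i-1}}{i}u^{\diamond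 i}\in kA[[\lambda]]$, where $u^{\bullet i}$ denotes the $i$-th power for the product $\bullet$. *)

(* Defs.v *)
From HB Require Import structures.
From mathcomp Require Import all_boot all_order all_algebra.
From mathcomp Require Import finmap.
From mathcomp Require Import monalg.

Set Implicit Arguments.
Unset Strict Implicit.
Unset Printing Implicit Defensive.

Import GRing.Theory.
Local Open Scope ring_scope.

(* [kA] has basis the letters [<< a >>]; [k<A>] is the algebra of the free    *)
(* monoid [{fmonom A}], so its ring product is concatenation.                 *)
Notation letters k A := ({malg k[A]}).
Notation words k A := ({malg k[{fmonom A}]}).

Section Words.
Variables (k : fieldType) (A : countType).

Definition word (s : seq A) : words k A := << FMonom s >>.

Definition letter (a : A) : words k A := word [:: a].

(* the inclusion of kA in k<A> *)
Definition emb (x : letters k A) : words k A :=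
  \sum_(a <- msupp x) x@_a *: letter a.

End Words.

Arguments word {k A} s.
Arguments letter {k A} a.

(* One recursion covers both products: [*] is [c = 1], the star product is    *)
(* [c = -1].                                                                  *)
Section QuasiShuffle.
Variables (k : fieldType) (A : countType).
Variable dia : {bilinear letters k A -> letters k A -> letters k A}.

Fixpoint qsh_word (c : k) (s : seq A) : seq A -> words k A :=
  fix qsh_word_s (t : seq A) : words k A :=
    match s, t with
    | [::], _ => word t
    | _, [::] => word s
    | a :: w, b :: v =>
        letter a * qsh_word c w t + letter b * qsh_word_s v
        + c *: (emb (dia << a >> << b >>) * qsh_word c w v)
    end.

Definition qsh (c : k) (f g : words k A) : words k A :=
  \sum_(u <- msupp f) \sum_(v <- msupp g) (f@_u * g@_v) *: qsh_word c u v.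

Definition qshuffle : words k A -> words k A -> words k A := qsh 1.

Definition qshuffle_star : words k A -> words k A -> words k A := qsh (-1).

End QuasiShuffle.

(* [V[[lambda]]]: the sequence of coefficients of a formal power series. *)
Definition fps (V : Type) := nat -> V.

Section PowerSeries.
Variables (k : fieldType) (V : lmodType k).
Implicit Types (m : V -> V -> V) (u v : fps V).

Definition fps_opp u : fps V := fun n => - u n.

(* multiplication by lambda *)
Definition fps_lambda u : fps V := fun n => if n is j.+1 then u j else 0.

(* the k[[lambda]]-bilinear continuous extension of a bilinear product *)
Definition fps_mul m u v : fps V :=
  fun n => \sum_(i < n.+1) m (u i) (v (n - i)%N).

(* The i-th power for i >= 1; no unit is needed, and the value at i = 0 is    *)
(* junk that is never used.                                                   *)
Definition fps_pow m u (i : nat) : fps V :=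
  iterop i (fps_mul m) u (fun=> 0).

(* The lambda-adic sum of F 1, F 2, ... when F i has order at least i: only   *)
(* F 1, ..., F n then contribute to the coefficient of lambda^n (see          *)
(* [fps_pow_order] and [fps_sum1_stable]).                                    *)
Definition fps_sum1 (F : nat -> fps V) : fps V :=
  fun n => \sum_(1 <= i < n.+1) F i n.

(* log (1 + u), for u of order at least 1 *)
Definition fps_log m u : fps V :=
  fps_sum1 (fun i n => ((-1) ^+ i.-1 / i%:R) *: fps_pow m u i n).

End PowerSeries.

Section WordSeries.
Variables (k : fieldType) (A : countType).
Implicit Types (m : words k A -> words k A -> words k A).
Implicit Types (u : fps (words k A)).

Definition fps_emb (x : fps (letters k A)) : fps (words k A) :=
  fun n => emb (x n).

Definition fps_one : fps (words k A) := fun n => if n is 0%N then 1 else 0.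

Definition fps_exp m u : fps (words k A) :=
  fun n => fps_one n
    + fps_sum1 (fun i n => (i`!%:R)^-1 *: fps_pow m u i n) n.

(* 1 / (1 - u), for u of order at least 1 *)
Definition fps_inv1B u : fps (words k A) :=
  fun n => fps_one n + fps_sum1 (fps_pow *%R u) n.

End WordSeries.

Section Checks.
Variables (k : fieldType) (A : countType).
Variable dia : {bilinear letters k A -> letters k A -> letters k A}.
Implicit Types (a b : A) (w v : seq A) (f g h : words k A) (c : k).

Lemma mulr_word w v : word w * word v = word (w ++ v) :> words k A.
Proof.
rewrite /word malgM_def /fgmul !msuppU oner_eq0 !big_seq_fset1 !mcoeffUU mulr1.
by congr (<< _ >>); apply/eqP; rewrite -val_eqE /= fmM.
Qed.

Lemma word_nil : word [::] = 1 :> words k A.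
Proof.
rewrite /word; congr (<< _ >>); apply/eqP; rewrite -val_eqE /=.
by rewrite fm1.
Qed.

Lemma emb_wide (x : letters k A) (d : {fset A}) : (msupp x `<=` d)%fset ->
  emb x = \sum_(a <- d) x@_a *: letter a.
Proof.
move=> le_d; rewrite /emb; apply: big_fset_incl => // a _ /mcoeff_outdom ->.
by rewrite scale0r.
Qed.

Lemma emb_linear : linear (@emb k A).
Proof.
move=> c x y.
pose d := (msupp x `|` msupp y `|` msupp (c *: x + y))%fset.
have [sx sy sxy] : [/\ msupp x `<=` d, msupp y `<=` d
    & msupp (c *: x + y) `<=` d]%fset.
  by split; apply/fsubsetP => a; rewrite !in_fsetU => ->; rewrite ?orbT.
rewrite (emb_wide sx) (emb_wide sy) (emb_wide sxy) scaler_sumr -big_split /=.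
by apply: eq_bigr => a _; rewrite mcoeffD mcoeffZ scalerDl scalerA.
Qed.

Lemma emb_letter a : emb << a >> = letter a :> words k A.
Proof. by rewrite /emb msuppU oner_eq0 big_seq_fset1 mcoeffUU scale1r. Qed.

Lemma qsh_wide c f g (d e : {fset {fmonom A}}) :
    (msupp f `<=` d)%fset -> (msupp g `<=` e)%fset ->
  qsh dia c f g
  = \sum_(u <- d) \sum_(v <- e) (f@_u * g@_v) *: qsh_word dia c u v.
Proof.
move=> le_d le_e; rewrite /qsh (big_fset_incl _ le_d) /=; last first.
  by move=> u _ /mcoeff_outdom ->; apply: big1 => v _; rewrite mul0r scale0r.
apply: eq_bigr => u _; apply: big_fset_incl => // v _ /mcoeff_outdom ->.
by rewrite mulr0 scale0r.
Qed.

Lemma qsh_linearl c g : linear ((qsh dia c)^~ g).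
Proof.
move=> x f h.
pose d := (msupp f `|` msupp h `|` msupp (x *: f + h))%fset.
have [sf sh sfh] : [/\ msupp f `<=` d, msupp h `<=` d
    & msupp (x *: f + h) `<=` d]%fset.
  by split; apply/fsubsetP => u; rewrite !in_fsetU => ->; rewrite ?orbT.
rewrite (qsh_wide c sf (fsubset_refl _)) (qsh_wide c sh (fsubset_refl _)).
rewrite (qsh_wide c sfh (fsubset_refl _)) scaler_sumr -big_split /=.
apply: eq_bigr => u _; rewrite scaler_sumr -big_split /=.
apply: eq_bigr => v _.
by rewrite mcoeffD mcoeffZ mulrDl scalerDl scalerA mulrA.
Qed.

Lemma qsh_linearr c f : linear (qsh dia c f).
Proof.
move=> x g h.
pose d := (msupp g `|` msupp h `|` msupp (x *: g + h))%fset.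
have [sg sh sgh] : [/\ msupp g `<=` d, msupp h `<=` d
    & msupp (x *: g + h) `<=` d]%fset.
  by split; apply/fsubsetP => u; rewrite !in_fsetU => ->; rewrite ?orbT.
rewrite (qsh_wide c (fsubset_refl _) sg) (qsh_wide c (fsubset_refl _) sh).
rewrite (qsh_wide c (fsubset_refl _) sgh) scaler_sumr -big_split /=.
apply: eq_bigr => u _; rewrite scaler_sumr -big_split /=.
apply: eq_bigr => v _.
by rewrite mcoeffD mcoeffZ mulrDr scalerDl scalerA mulrCA.
Qed.

Lemma qsh_words c w v : qsh dia c (word w) (word v) = qsh_word dia c w v.
Proof.
by rewrite /qsh !msuppU oner_eq0 !big_seq_fset1 !mcoeffUU mulr1 scale1r.
Qed.

Lemma qsh_word0s c v : qsh_word dia c [::] v = word v.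
Proof. by case: v. Qed.

Lemma qsh_words0 c w : qsh_word dia c w [::] = word w.
Proof. by case: w. Qed.

Lemma word_sum f : f = \sum_(u <- msupp f) f@_u *: word u.
Proof.
rewrite {1}[f]monalgE; apply: eq_bigr => u _.
rewrite /word; apply/malgP => x; rewrite mcoeffZ !mcoeffU.
have -> : FMonom u = u by case: u.
by case: eqP => _; rewrite ?mulr1 ?mulr0.
Qed.

Lemma qsh1l c g : qsh dia c 1 g = g.
Proof.
rewrite -word_nil /qsh /word msuppU oner_eq0 big_seq_fset1 mcoeffUU.
rewrite [RHS]word_sum; apply: eq_bigr => v _.
by rewrite mul1r qsh_word0s.
Qed.

Lemma qsh1r c f : qsh dia c f 1 = f.
Proof.
rewrite -word_nil /qsh [RHS]word_sum; apply: eq_bigr => u _.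
by rewrite /word msuppU oner_eq0 big_seq_fset1 mcoeffUU mulr1 qsh_words0.
Qed.

Lemma qshuffle_rec a b w v : let m := qshuffle dia in
  m (word (a :: w)) (word (b :: v)) =
    letter a * m (word w) (word (b :: v))
    + letter b * m (word (a :: w)) (word v)
    + emb (dia << a >> << b >>) * m (word w) (word v).
Proof. by rewrite /= /qshuffle !qsh_words /= scale1r. Qed.

Lemma qshuffle_star_rec a b w v : let m := qshuffle_star dia in
  m (word (a :: w)) (word (b :: v)) =
    letter a * m (word w) (word (b :: v))
    + letter b * m (word (a :: w)) (word v)
    - emb (dia << a >> << b >>) * m (word w) (word v).
Proof. by rewrite /= /qshuffle_star !qsh_words /= scaleN1r. Qed.

End Checks.

Section Convergence.
Variables (k : fieldType) (V : lmodType k) (m : V -> V -> V).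
Hypotheses (m0l : forall x, m 0 x = 0) (m0r : forall x, m x 0 = 0).

Lemma fps_pow_order (u : fps V) i n :
  u 0%N = 0 -> (n < i)%N -> fps_pow m u i n = 0.
Proof.
move=> u0; case: i => // i; rewrite /fps_pow iteropS.
elim: i n => [|i IHi] n; first by case: n.
move=> lt_n; apply: big1 => -[[|j] lt_j] _; first by rewrite u0 m0l.
case: n lt_n lt_j => [|n] lt_n lt_j //.
by rewrite [X in m _ X]IHi ?m0r //= subSS (leq_ltn_trans (leq_subr _ _)).
Qed.

Lemma fps_sum1_stable (F : nat -> fps V) n N :
    (forall i j, (j < i)%N -> F i j = 0) -> (n <= N)%N ->
  fps_sum1 F n = \sum_(1 <= i < N.+1) F i n.
Proof.
move=> F0 le_nN; rewrite /fps_sum1 (@big_cat_nat _ _ _ n.+1 1 N.+1) //=.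
rewrite [X in _ + X]big1_seq ?addr0 // => i.
by rewrite mem_index_iota => /andP[_ /andP[/F0]].
Qed.

End Convergence.

(* Main.v *)
Require Import Defs.
From HB Require Import structures.
From mathcomp Require Import all_boot all_order all_algebra.
From mathcomp Require Import finmap monalg.

Set Implicit Arguments.
Unset Strict Implicit.
Unset Printing Implicit Defensive.

Import GRing.Theory.
Local Open Scope ring_scope.

(** Write [D_x w] for the product of a combination of letters [x] with [w]
in the quasi-shuffle algebra of parameter [c], the two products of interest
being [c = 1] and [c = -1].  The identity holds because both of its sides
solve the same linear differential equation in [lambda].

Let [x] and [v] be series of order at least 1 with coefficients in [kA] such
that [x' + c (x' <> v) = v'], where [<>] is the product on letters.

- The operators [D_x], for [x] in [kA], commute ([qsh_emb_CA]).  So the powers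
  of [x] differentiate as in a commutative algebra, and the exponential [E] of
  [x] satisfies [E' = D_(x') E] ([fps_exp_ode]).

- The defining recursion reads
  [D_x (y w) = x y w + y (D_x w) + c (x <> y) w] for [x], [y] in [kA] and any
  [w] ([qsh_cons_rule]).  Apply it to [G = 1/(1 - v)], that is to
  [G = 1 + v G]: this gives
  [D_(x') G = (x' + c (x' <> v)) G + v (D_(x') G) = v' G + v (D_(x') G)].
  The derivative satisfies [G' = v' G + v G'] as well, and since [v] has order
  at least 1 this fixed-point equation has one solution, so [G' = D_(x') G]
  ([fps_inv_ode]).

- In characteristic zero a series is determined by such an equation and its
  constant coefficient ([fps_ode_unique]), hence [E = G] ([fps_exp_sh]).

Finally, telescoping shows that [L = log (1 + u)] satisfies [L' + u <> L' = u']
([fps_log_ode]).  For [c = 1] or [c = -1] one has [c * c = 1], so [x = c L] and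
[v = c u] meet the requirement, and [u = lambda z] gives both identities.

The differential equations use nothing but bilinearity, right units, the
recursion and the commutation of the [D_x], so they are stated for two bilinear
products on an arbitrary module; words come in to establish the recursion and,
by induction on their length, the commutation. *)

(** * Sums over triangles of indices *)

Section TriangularSums.
Variables (V : nmodType).

Lemma exchange_triangle (T : nat -> nat -> V) n :
  \sum_(i < n.+1) \sum_(j < (n - i).+1) T i j
  = \sum_(j < n.+1) \sum_(i < (n - j).+1) T i j.
Proof.
have widen (F : nat -> nat -> V) : \sum_(i < n.+1) \sum_(j < (n - i).+1) F i j
    = \sum_(i < n.+1) \sum_(j < n.+1 | (i + j <= n)%N) F i j.
  apply: eq_bigr => i _.
  rewrite (big_ord_widen n.+1 (F i)) ?ltnS ?leq_subr //.
  by apply: eq_bigl => j; rewrite ltnS leq_subRL // -ltnS.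
rewrite widen (widen (fun j i => T i j)) (exchange_big_dep predT) //=.
by apply: eq_bigr => j _; apply: eq_bigl => i; rewrite addnC.
Qed.

Lemma reindex_triangle (T : nat -> nat -> nat -> V) n :
  \sum_(k < n.+1) \sum_(i < k.+1) T i (k - i)%N (n - k)%N
  = \sum_(i < n.+1) \sum_(j < (n - i).+1) T i j (n - i - j)%N.
Proof.
rewrite (eq_bigr (fun k : 'I_n.+1 => \sum_(i < n.+1 | (i < k.+1)%N)
   T i (k - i)%N (n - k)%N)); last first.
  by move=> k _; rewrite (big_ord_widen n.+1 (fun i => T i (k - i) (n - k))%N).
rewrite (exchange_big_dep predT) //=; apply: eq_bigr => i _.
rewrite -(big_mkord (fun k => i < k.+1)%N (fun k => T i (k - i) (n - k))%N).
rewrite -(big_mkord predT (fun j => T i j (n - i - j))%N).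
have le_in : (i <= n)%N by rewrite -ltnS.
rewrite (@big_cat_nat _ _ _ i) //=; last exact: ltnW (ltn_ord i).
rewrite big_nat_cond big1 ?add0r; last first.
  by move=> k /andP[/andP[_ lt_ki]]; rewrite ltnS leqNgt lt_ki.
rewrite -{1}[i : nat]add0n big_addn subSn //.
apply: eq_big => j; first by rewrite ltnS leq_addl.
by rewrite addnK -subnDA addnC.
Qed.

End TriangularSums.

(** * Cauchy products, derivatives and linear differential equations *)

Section SeriesProduct.
Variables (k : fieldType) (V : lmodType k).
Variable m : {bilinear V -> V -> V}.
Implicit Types u v w : fps V.

Definition fps_deriv u : fps V := fun n => u n.+1 *+ n.+1.

Lemma eq_fps_mul u u' v v' n :
    (forall i, (i <= n)%N -> u i = u' i) ->
    (forall i, (i <= n)%N -> v i = v' i) ->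
  fps_mul m u v n = fps_mul m u' v' n.
Proof.
move=> eq_u eq_v; apply: eq_bigr => i _.
by rewrite eq_u ?eq_v ?leq_subr // -ltnS.
Qed.

Lemma fps_mulDl u u' v n :
  fps_mul m (fun i => u i + u' i) v n = fps_mul m u v n + fps_mul m u' v n.
Proof. by rewrite -big_split; apply: eq_bigr => i _; rewrite linearDl. Qed.

Lemma fps_mulDr u v v' n :
  fps_mul m u (fun i => v i + v' i) n = fps_mul m u v n + fps_mul m u v' n.
Proof. by rewrite -big_split; apply: eq_bigr => i _; rewrite linearDr. Qed.

Lemma fps_mulMnr u v d n :
  fps_mul m u (fun i => v i *+ d) n = fps_mul m u v n *+ d.
Proof. by rewrite -sumrMnl; apply: eq_bigr => i _; rewrite linearMnr. Qed.

Lemma fps_mul_sumr u (a : nat -> k) (F : nat -> fps V) N n :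
  fps_mul m u (fun j => \sum_(0 <= i < N) a i *: F i j) n
  = \sum_(0 <= i < N) a i *: fps_mul m u (F i) n.
Proof.
under [LHS]eq_bigr do rewrite linear_sumr.
rewrite exchange_big; apply: eq_bigr => i _; rewrite scaler_sumr.
by apply: eq_bigr => j _; rewrite linearZr_LR.
Qed.

(** Only the coefficients of [u] and [v] are asked to act by commuting
operators: for the quasi-shuffle product, the recursion gives this directly on
combinations of letters. *)
Lemma fps_mulCA u v w n :
    (forall i j x, m (u i) (m (v j) x) = m (v j) (m (u i) x)) ->
  fps_mul m u (fps_mul m v w) n = fps_mul m v (fps_mul m u w) n.
Proof.
move=> mCA; rewrite /fps_mul.
under eq_bigr do rewrite linear_sumr.
under [RHS]eq_bigr do rewrite linear_sumr.
rewrite (exchange_triangle (fun i j => m (u i) (m (v j) (w (n - i - j)%N)))).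
by do 2![apply: eq_bigr => ? _]; rewrite mCA subnAC.
Qed.

Lemma fps_mulC u v n : (forall i j, m (u i) (v j) = m (v j) (u i)) ->
  fps_mul m u v n = fps_mul m v u n.
Proof.
move=> mC; rewrite /fps_mul (reindex_inj rev_ord_inj) /=.
by apply: eq_bigr => i _; rewrite subSS mC subKn // -ltnS.
Qed.

Lemma fps_deriv_mul u v n :
  fps_deriv (fps_mul m u v) n
  = fps_mul m (fps_deriv u) v n + fps_mul m u (fps_deriv v) n.
Proof.
rewrite /fps_deriv /fps_mul -sumrMnl.
have -> : \sum_(i < n.+2) m (u i) (v (n.+1 - i)%N) *+ n.+1
    = \sum_(i < n.+2) m (u i) (v (n.+1 - i)%N) *+ i
      + \sum_(i < n.+2) m (u i) (v (n.+1 - i)%N) *+ (n.+1 - i).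
  rewrite -big_split; apply: eq_bigr => i _ /=.
  by rewrite -mulrnDr subnKC // -ltnS.
congr (_ + _).
  rewrite big_ord_recl mulr0n add0r; apply: eq_bigr => i _ /=.
  by rewrite linearMnl subSS.
rewrite big_ord_recr /= subnn mulr0n addr0; apply: eq_bigr => i _ /=.
by rewrite linearMnr subSn // -ltnS.
Qed.

(** The power rule, for a sequence [Q] of successive left multiples by [u].
The offset [e] accommodates both numberings of powers: [e = 1] if [Q] starts at
a unit, [e = 2] if it starts at [u] because the product has no unit. *)
Lemma fps_deriv_powers u (Q : nat -> fps V) e :
    (forall i j x, m (u i) (m (u j) x) = m (u j) (m (u i) x)) ->
    (forall i, Q i.+1 =1 fps_mul m u (Q i)) ->
    (forall n, fps_deriv (Q 1%N) n = fps_mul m (fps_deriv u) (Q 0%N) n *+ e) ->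
  forall i n,
    fps_deriv (Q i.+1) n = fps_mul m (fps_deriv u) (Q i) n *+ (i + e).
Proof.
move=> mCA QS Q1 i; elim: i => [|i IHi] n; first by rewrite Q1.
rewrite /fps_deriv QS -[LHS]/(fps_deriv (fps_mul m u (Q i.+1)) n).
rewrite fps_deriv_mul (eq_fps_mul (fun _ _ => erefl) (fun j _ => IHi j)).
rewrite fps_mulMnr fps_mulCA; last first.
  by move=> p q x; rewrite /fps_deriv !linearMnl linearMnr mCA.
rewrite [X in _ + X *+ _](eq_fps_mul (fun _ _ => erefl)
  (fun j _ => esym (QS i j))).
by rewrite addSn mulrS.
Qed.

(** The equation gives [(n + 1) X_(n + 1)] in terms of [X_0, ..., X_n]. *)
Lemma fps_ode_unique (a X Y : fps V) :
    (forall n (x : V), x *+ n.+1 = 0 -> x = 0) ->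
    X 0%N = Y 0%N ->
    (forall n, fps_deriv X n = fps_mul m a X n) ->
    (forall n, fps_deriv Y n = fps_mul m a Y n) ->
  X =1 Y.
Proof.
move=> char0 eq0 dX dY n; elim/ltn_ind: n => -[|n] IHn //.
apply/eqP; rewrite -subr_eq0; apply/eqP/(char0 n); rewrite mulrnBl.
apply/eqP; rewrite subr_eq0 -[X in X == _]/(fps_deriv X n) dX.
rewrite -[eqbRHS]/(fps_deriv Y n) dY; apply/eqP.
by apply: eq_fps_mul => // i le_in; rewrite IHn.
Qed.

End SeriesProduct.

(** * Fields containing the rational numbers *)

Lemma natr_neq0_rat (k : fieldType) (iota : {rmorphism rat -> k}) n :
  n.+1%:R != 0 :> k.
Proof. by rewrite -(rmorph_nat iota) fmorph_eq0 Num.Theory.pnatr_eq0. Qed.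

Lemma lmod_mulrn_eq0_rat (k : fieldType) (iota : {rmorphism rat -> k})
    (V : lmodType k) n (x : V) :
  x *+ n.+1 = 0 -> x = 0.
Proof.
move/eqP; rewrite -scaler_nat scaler_eq0.
by rewrite (negbTE (natr_neq0_rat iota n)) => /eqP.
Qed.

(** * The logarithm in a commutative algebra without unit *)

Section Logarithm.
Variables (k : fieldType) (iota : {rmorphism rat -> k}) (V : lmodType k).
Variable dia : {bilinear V -> V -> V}.
Hypotheses (diaA : associative dia) (diaC : commutative dia).
Variable u : fps V.
Hypothesis u0 : u 0%N = 0.

(* The products of [u'] with the powers of [u]; the case [i = 0] is separate
   since there is no unit to serve as the power of exponent 0. *)
Local Notation log_term :=
  (fun i => if i is j.+1 then fps_mul dia (fps_deriv u) (fps_pow dia u j.+1)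
            else fps_deriv u).

Lemma dia_CA x y w : dia x (dia y w) = dia y (dia x w).
Proof. by rewrite !diaA (diaC x). Qed.

Lemma fps_deriv_pow i n :
  fps_deriv (fps_pow dia u i.+1) n = log_term i n *+ i.+1.
Proof.
case: i => // i.
rewrite (@fps_deriv_powers _ _ dia u (fun j => fps_pow dia u j.+1) 2) ?addn2 //.
  by move=> *; rewrite dia_CA.
move=> j; rewrite -[fps_pow dia u 2]/(fps_mul dia u u) fps_deriv_mul.
by rewrite (@fps_mulC _ _ _ u) // mulr2n.
Qed.

Lemma fps_mul_log_term i n : fps_mul dia u (log_term i) n = log_term i.+1 n.
Proof.
case: i => [|i]; first by rewrite fps_mulC.
by rewrite fps_mulCA // => *; rewrite dia_CA.
Qed.

Lemma log_term_order i n : (n < i)%N -> log_term i n = 0.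
Proof.
case: i => // i lt_ni; apply: big1 => j _; rewrite fps_pow_order ?linear0r //.
- exact: linear0l.
- exact: linear0r.
- exact: leq_ltn_trans (leq_subr _ _) lt_ni.
Qed.

Lemma fps_deriv_log n N : (n < N)%N ->
  fps_deriv (fps_log dia u) n = \sum_(0 <= i < N) (-1) ^+ i *: log_term i n.
Proof.
move=> lt_nN; rewrite /fps_deriv /fps_log (@fps_sum1_stable _ _ _ _ N) //.
  rewrite -sumrMnl big_add1; apply: eq_bigr => i _.
  rewrite scalerMnr -[X in _ *: X]/(fps_deriv (fps_pow dia u i.+1) n).
  rewrite fps_deriv_pow -scaler_nat scalerA -mulrA mulVf ?mulr1 //.
  exact: natr_neq0_rat iota i.
move=> i j lt_ji; rewrite fps_pow_order ?scaler0 //.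
- exact: linear0l.
- exact: linear0r.
Qed.

(** Multiplying [L' = u' - u <> u' + u <> u <> u' - ...] by [u] shifts the terms
by one, so that [L' + u <> L'] telescopes to [u']. *)
Lemma fps_log_ode n :
  fps_deriv (fps_log dia u) n + fps_mul dia u (fps_deriv (fps_log dia u)) n
  = fps_deriv u n.
Proof.
(* The cut at [n.+1] is valid for all coefficients up to [n], and the last term
   of the telescoping sum then has order greater than [n]. *)
rewrite (@fps_deriv_log _ n.+1) //.
rewrite (eq_fps_mul _ (fun _ _ => erefl)
  (fun i le_in => @fps_deriv_log i n.+1 le_in)).
rewrite fps_mul_sumr -big_split /=.
have telescope N : \sum_(0 <= i < N)
    ((-1) ^+ i *: log_term i n + (-1) ^+ i *: fps_mul dia u (log_term i) n)
    = fps_deriv u n - (-1) ^+ N *: log_term N n :> V.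
  elim: N => [|N IHN]; first by rewrite big_geq // scale1r subrr.
  rewrite big_nat_recr //= IHN fps_mul_log_term addrA subrK.
  by rewrite exprS mulN1r scaleNr opprK.
by rewrite telescope (@log_term_order n.+1) // scaler0 subr0.
Qed.

(** Multiplying [fps_log_ode] by [c]: three factors [c] come with [x' <> v], and
[c * c = 1] reduces them to one. *)
Lemma fps_log_scale_ode (c : k) n : c * c = 1 ->
  let x i := c *: fps_log dia u i in let v i := c *: u i in
  fps_deriv x n + c *: fps_mul dia (fps_deriv x) v n = fps_deriv v n.
Proof.
move=> cc1 x v; rewrite [RHS]scalerMnr -[X in _ = c *: X]/(fps_deriv u n).
rewrite -fps_log_ode scalerDr; congr (_ + _); first exact: scalerMnr.
rewrite [in RHS]fps_mulC // scaler_sumr [RHS]scaler_sumr.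
apply: eq_bigr => i _.
rewrite /fps_deriv /x scalerMnr linearZl_LR linearZr_LR /=.
by rewrite scalerA cc1 scale1r.
Qed.

End Logarithm.

(** * Exponential and geometric series for a product with right unit *)

Section UnitalPowers.
Variables (k : fieldType) (V : lmodType k).
Variables (m : {bilinear V -> V -> V}) (one : V).
Hypothesis m1r : right_id one m.
Implicit Types (a : nat -> k) (u : fps V).

Definition fps_const : fps V := fun n => if n is 0%N then one else 0.

Definition fps_upow u i : fps V :=
  if i is 0%N then fps_const else fps_pow m u i.

(** The value at [u] of the series with constant coefficient 1 and higher
coefficients [a 1, a 2, ...]: the exponential for [a i = 1 / i!], and
[1 / (1 - u)] for [a] constantly 1. *)
Definition fps_subst a u : fps V :=
  fun n => fps_const n + fps_sum1 (fun i n => a i *: fps_pow m u i n) n.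

Lemma eq_fps_subst a u u' : u =1 u' -> fps_subst a u =1 fps_subst a u'.
Proof.
move=> eq_u n; congr (_ + _); apply: eq_bigr => -[|i] _ //; congr (_ *: _).
elim: i n => [|i IHi] n; first exact: eq_u.
rewrite -[LHS]/(fps_mul m u (fps_pow m u i.+1) n).
by apply: eq_fps_mul => // j _.
Qed.

Lemma fps_mul_const u : fps_mul m u fps_const =1 u.
Proof.
move=> n; rewrite /fps_mul big_ord_recr /= subnn /= m1r big1 ?add0r // => i _.
by rewrite /fps_const -(subnSK (ltn_ord i)) /= linear0r.
Qed.

Lemma fps_upowS u i : fps_upow u i.+1 =1 fps_mul m u (fps_upow u i).
Proof. by case: i => [|i] n //; rewrite fps_mul_const. Qed.

Section OrderOne.
Variable u : fps V.
Hypothesis u0 : u 0%N = 0.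

Lemma fps_substE a N n : a 0%N = 1 -> (n < N)%N ->
  fps_subst a u n = \sum_(0 <= i < N) a i *: fps_upow u i n.
Proof.
move=> a0; case: N => // N lt_nN.
rewrite /fps_subst (@fps_sum1_stable _ _ _ _ N) // => [|i j lt_ji].
  rewrite [RHS]big_ltn // a0 scale1r; congr (_ + _).
  by rewrite !big_add1.
rewrite fps_pow_order ?scaler0 //.
- exact: linear0l.
- exact: linear0r.
Qed.

Lemma fps_inv_fix n : let G := fps_subst (fun=> 1) u in
  G n = fps_const n + fps_mul m u G n.
Proof.
move=> G; rewrite {1}/G (@fps_substE _ n.+2) // big_nat_recl // scale1r.
congr (_ + _).
rewrite (eq_fps_mul _ (fun _ _ => erefl)
  (fun i le_in => @fps_substE (fun=> 1) n.+1 i erefl le_in)).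
by rewrite fps_mul_sumr; apply: eq_bigr => i _; rewrite fps_upowS.
Qed.

Lemma fps_exp_ode (iota : {rmorphism rat -> k}) :
    (forall i j x, m (u i) (m (u j) x) = m (u j) (m (u i) x)) ->
  let E := fps_subst (fun i => (i`!%:R)^-1) u in
  forall n, fps_deriv E n = fps_mul m (fps_deriv u) E n.
Proof.
move=> uCA E n; pose a i : k := (i`!%:R)^-1.
have a0 : a 0%N = 1 by rewrite /a invr1.
rewrite (eq_fps_mul _ (fun _ _ => erefl)
  (fun i le_in => @fps_substE a n.+1 i a0 le_in)) fps_mul_sumr.
rewrite /fps_deriv /E (@fps_substE a n.+2) // big_nat_recl // scaler0 add0r.
rewrite -sumrMnl; apply: eq_bigr => i _.
rewrite scalerMnr -[X in _ *: X]/(fps_deriv (fps_upow u i.+1) n).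
rewrite (@fps_deriv_powers _ _ m u (fps_upow u) 1) //; first last.
- move=> j; rewrite mulr1n fps_mul_const.
  by rewrite /fps_deriv fps_upowS fps_mul_const.
- exact: fps_upowS.
rewrite addn1 -scaler_nat scalerA /a factS natrM invfM mulrAC.
by rewrite mulVf ?mul1r // (natr_neq0_rat iota).
Qed.

End OrderOne.
End UnitalPowers.

(** * Modules with a quasi-shuffle recursion *)

Section ConsRule.
Variables (k : fieldType) (L V : lmodType k) (c : k).
Variables (dia : {bilinear L -> L -> L}) (emb : {linear L -> V}).
Variables (cat sh : {bilinear V -> V -> V}).

(** The quasi-shuffle recursion with a single letter as left argument; [cat]
stands for concatenation and [sh] for the quasi-shuffle product. *)
Definition cons_rule x y w :=
  sh (emb x) (cat (emb y) w)
  = cat (emb x) (cat (emb y) w) + cat (emb y) (sh (emb x) w)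
    + c *: cat (emb (dia x y)) w.

Lemma scale_add3 (r : k) (w1 w2 w3 v1 v2 v3 : V) :
  r *: (w1 + w2 + c *: w3) + (v1 + v2 + c *: v3)
  = (r *: w1 + v1) + (r *: w2 + v2) + c *: (r *: w3 + v3).
Proof.
by rewrite !scalerDr !scalerA (mulrC c) addrACA [X in X + _ = _]addrACA.
Qed.

Lemma cons_rule_linear_word r x y w w' :
  cons_rule x y w -> cons_rule x y w' -> cons_rule x y (r *: w + w').
Proof. by rewrite /cons_rule !linearPr /= => -> ->; exact: scale_add3. Qed.

Lemma cons_rule_linearl r x x' y w :
  cons_rule x y w -> cons_rule x' y w -> cons_rule (r *: x + x') y w.
Proof.
rewrite /cons_rule linearPl !linearP /= !linearPl /= !linearPr /= => -> ->.
exact: scale_add3.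
Qed.

Lemma cons_rule_linearr r x y y' w :
  cons_rule x y w -> cons_rule x y' w -> cons_rule x (r *: y + y') w.
Proof.
rewrite /cons_rule linearPr !linearP /= !linearPl /= !linearPr /= => -> ->.
exact: scale_add3.
Qed.

Lemma cons_rule0l y w : cons_rule 0 y w.
Proof.
by rewrite /cons_rule !(linear0l, linear0r, linear0, scaler0, addr0).
Qed.

Lemma cons_rule0r x w : cons_rule x 0 w.
Proof.
by rewrite /cons_rule !(linear0l, linear0r, linear0, scaler0, addr0).
Qed.

Hypothesis consP : forall x y w, cons_rule x y w.
Hypotheses (diaA : associative dia) (diaC : commutative dia).
Variable one : V.
Hypotheses (cat1r : right_id one cat) (sh1r : right_id one sh).

Lemma sh_CA_one x y :
  sh (emb x) (sh (emb y) one) = sh (emb y) (sh (emb x) one).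
Proof.
have shE x' y' : sh (emb x') (emb y')
    = cat (emb x') (emb y') + cat (emb y') (emb x') + c *: emb (dia x' y').
  by rewrite -[emb y' in LHS]cat1r consP sh1r !cat1r.
by rewrite !sh1r !shE (diaC x) (addrC (cat (emb x) _)).
Qed.

Lemma sh_CA_linear r x y w w' :
    sh (emb x) (sh (emb y) w) = sh (emb y) (sh (emb x) w) ->
    sh (emb x) (sh (emb y) w') = sh (emb y) (sh (emb x) w') ->
  sh (emb x) (sh (emb y) (r *: w + w')) = sh (emb y) (sh (emb x) (r *: w + w')).
Proof. by move=> IH IH'; rewrite !linearPr /= IH IH'. Qed.

(** Expanding the left side by the recursion gives eleven terms.  Exchanging [x]
and [y] swaps eight of them in pairs and fixes the other three: the one with
[dia x y] in front, the one with [dia (dia x y) a], since [dia] is commutative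
and associative, and the one that starts with [a], by the hypothesis on [w]. *)
Lemma sh_CA_cons x y a w :
    sh (emb x) (sh (emb y) w) = sh (emb y) (sh (emb x) w) ->
  sh (emb x) (sh (emb y) (cat (emb a) w))
  = sh (emb y) (sh (emb x) (cat (emb a) w)).
Proof.
move=> IH; rewrite !consP !linearDr !linearZr_LR /= !consP IH.
rewrite !linearDr !scalerDr !linearZr_LR /= !addrA !diaA (diaC y x).
(* The swapped pairs are 1-2, 3-6, 4-9 and 8-10. *)
by rewrite [LHS](ACl (2*1*6*9*5*3*7*10*4*8*11)).
Qed.

Implicit Types (x y v : fps L).

Local Notation emb_fps x := (fun n => emb (x n)).

Lemma fps_consP y v (w : fps V) n :
  fps_mul sh (emb_fps y) (fps_mul cat (emb_fps v) w) n
  = fps_mul cat (emb_fps y) (fps_mul cat (emb_fps v) w) n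
    + fps_mul cat (emb_fps v) (fps_mul sh (emb_fps y) w) n
    + c *: fps_mul cat (emb_fps (fps_mul dia y v)) w n.
Proof.
rewrite /fps_mul.
under eq_bigr do rewrite linear_sumr.
under [X in X + _ + _]eq_bigr do rewrite linear_sumr.
under [X in _ + X + _]eq_bigr do rewrite linear_sumr.
under [X in _ + _ *: X]eq_bigr do rewrite linear_sum linear_sumlz.
rewrite (exchange_triangle
  (fun i j => cat (emb (v i)) (sh (emb (y j)) (w (n - i - j)%N)))).
rewrite (reindex_triangle (fun i j l => cat (emb (dia (y i) (v j))) (w l))).
rewrite scaler_sumr -!big_split; apply: eq_bigr => i _ /=.
rewrite scaler_sumr -!big_split; apply: eq_bigr => j _ /=.
by rewrite consP subnAC.
Qed.

(** The derivative of [G] and the product of [y] with [G] both satisfy the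
fixed-point equation [F = v' G + v F], whose solution is unique because [v] has
order at least 1. *)
Lemma fps_inv_ode y v : v 0%N = 0 ->
    (forall n, y n + c *: fps_mul dia y v n = fps_deriv v n) ->
  let G := fps_subst cat one (fun=> 1) (emb_fps v) in
  forall n, fps_deriv G n = fps_mul sh (emb_fps y) G n.
Proof.
move=> v0 dv G; have ev0 : emb (v 0%N) = 0 by rewrite v0 linear0.
have GE n : G n = fps_const one n + fps_mul cat (emb_fps v) G n.
  exact: (@fps_inv_fix _ _ _ _ cat1r (emb_fps v)).
have dG n : fps_deriv G n = fps_mul cat (emb_fps (fps_deriv v)) G n
    + fps_mul cat (emb_fps v) (fps_deriv G) n.
  rewrite {1}/fps_deriv GE add0r.
  rewrite -[LHS]/(fps_deriv (fps_mul cat (emb_fps v) G) n) fps_deriv_mul.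
  congr (_ + _); apply: eq_fps_mul => // i _.
  by rewrite /fps_deriv linearMn.
have shG n : fps_mul sh (emb_fps y) G n
    = fps_mul cat (emb_fps (fps_deriv v)) G n
      + fps_mul cat (emb_fps v) (fps_mul sh (emb_fps y) G) n.
  rewrite (eq_fps_mul _ (fun _ _ => erefl) (fun i _ => GE i)).
  rewrite fps_mulDr fps_consP.
  rewrite (fps_mul_const sh1r) -{1}(fps_mul_const cat1r (emb_fps y) n).
  rewrite !addrA -fps_mulDr addrAC; congr (_ + _).
  rewrite -(eq_fps_mul _ (fun _ _ => erefl) (fun i _ => GE i)).
  have -> : c *: fps_mul cat (emb_fps (fps_mul dia y v)) G n
      = fps_mul cat (fun i => c *: emb (fps_mul dia y v i)) G n.
    by rewrite scaler_sumr; apply: eq_bigr => i _; rewrite linearZl_LR.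
  rewrite -fps_mulDl; apply: eq_fps_mul => // i _.
  by rewrite -dv linearD linearZ.
move=> n; elim/ltn_ind: n => n IHn; rewrite dG shG; congr (_ + _).
apply: eq_bigr => -[[|i] lt_in] _ /=; first by rewrite ev0 !linear0l.
by rewrite IHn // ltn_subrL (leq_trans _ (lt_in : (i.+1 <= n)%N)).
Qed.

Lemma fps_exp_sh (iota : {rmorphism rat -> k}) x v :
    x 0%N = 0 -> v 0%N = 0 ->
    (forall i j w, sh (emb (x i)) (sh (emb (x j)) w)
      = sh (emb (x j)) (sh (emb (x i)) w)) ->
    (forall n, fps_deriv x n + c *: fps_mul dia (fps_deriv x) v n
      = fps_deriv v n) ->
  fps_subst sh one (fun i => (i`!%:R)^-1) (emb_fps x)
  =1 fps_subst cat one (fun=> 1) (emb_fps v).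
Proof.
move=> x0 v0 xCA dv.
apply: (@fps_ode_unique _ _ sh (emb_fps (fps_deriv x))).
- exact: lmod_mulrn_eq0_rat iota V.
- by rewrite /fps_subst /fps_sum1 !big_geq.
- move=> n; rewrite fps_exp_ode ?x0 ?linear0 //.
  by apply: eq_fps_mul => // i _; rewrite /fps_deriv linearMn.
- exact: fps_inv_ode.
Qed.

End ConsRule.

(** * The algebra of words *)

Section WordAlgebra.
Variables (k : fieldType) (A : countType).
Implicit Types w v : words k A.

Lemma words_ind (P : words k A -> Prop) :
    (forall a w v, P w -> P v -> P (a *: w + v)) -> (forall s, P (word s)) ->
  forall w, P w.
Proof.
move=> Plin Pword w; rewrite [w]word_sum; elim/big_rec: _ => [|s v _ Pv].
  rewrite -(addNr (word [::])) -scaleN1r; exact: Plin.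
exact: Plin.
Qed.

Lemma malgZU (K : choiceType) (a b : k) (x : K) :
  a *: << b *g x >> = << a * b *g x >> :> {malg k[K]}.
Proof. by apply/malgP => y; rewrite mcoeffZ !mcoeffU mulrnAr. Qed.

Lemma letters_ind (P : letters k A -> Prop) :
    (forall a x y, P x -> P y -> P (a *: x + y)) -> (forall a, P << a >>) ->
    P 0 ->
  forall x, P x.
Proof.
move=> Plin Pletter P0 x; rewrite [x]monalgE; elim/big_rec: _ => // a y _ Py.
by rewrite -[x@_a]mulr1 -malgZU; exact: Plin.
Qed.

Lemma mulr_malgC (a : k) w : w * a%:MP = a *: w.
Proof.
rewrite malgM_def malgZ_def fgmulgU.
by apply/eq_bigr => s _; rewrite mulm1 mulrC.
Qed.

Lemma words_scalerAr (a : k) w v : a *: (w * v) = w * (a *: v).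
Proof. by rewrite -(mul_malgC a v) mulrA mulr_malgC scalerAl. Qed.

Lemma concat_bilinear : bilinear_for *:%R *:%R (@GRing.mul (words k A)).
Proof.
split=> [v a w w'|w a v v']; first by rewrite /= mulrDl scalerAl.
by rewrite /= mulrDr words_scalerAr.
Qed.

HB.instance Definition _ :=
  bilinear_isBilinear.Build k (words k A) (words k A) (words k A) *:%R *:%R
    (@GRing.mul (words k A)) concat_bilinear.

HB.instance Definition _ :=
  GRing.isLinear.Build k (letters k A) (words k A) *:%R (@emb k A)
    (@emb_linear k A).

End WordAlgebra.

(** * Quasi-shuffle products of words *)

Section QuasiShuffleAlgebra.
Variables (k : fieldType) (A : countType).
Variable dia : {bilinear letters k A -> letters k A -> letters k A}.
Variable c : k.

Lemma qsh_bilinear : bilinear_for *:%R *:%R (qsh dia c).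
Proof. by split=> ?; [exact: qsh_linearl | exact: qsh_linearr]. Qed.

HB.instance Definition _ :=
  bilinear_isBilinear.Build k (words k A) (words k A) (words k A) *:%R *:%R
    (qsh dia c) qsh_bilinear.

Local Notation cat := (@GRing.mul (words k A)).

Lemma qsh_word_cons a b s t :
  qsh_word dia c (a :: s) (b :: t)
  = letter a * qsh_word dia c s (b :: t) + letter b * qsh_word dia c (a :: s) t
    + c *: (emb (dia << a >> << b >>) * qsh_word dia c s t).
Proof. by []. Qed.

(** The recursion that defines the product on words, extended from basis
elements by trilinearity. *)
Lemma qsh_cons_rule x y (w : words k A) :
  cons_rule c dia (@emb k A) cat (qsh dia c) x y w.
Proof.
elim/letters_ind: x => [r x x' IHx IHx'|a|].
- exact: cons_rule_linearl IHx IHx'.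
- elim/letters_ind: y => [r y y' IHy IHy'|b|].
  + exact: cons_rule_linearr IHy IHy'.
  + elim/words_ind: w => [r w w' IHw IHw'|t].
      exact: cons_rule_linear_word IHw IHw'.
    have catE : letter b * word t = word (b :: t) := mulr_word k [:: b] t.
    have shE s : qsh dia c (letter a) (word s) = qsh_word dia c [:: a] s.
      exact: qsh_words.
    by rewrite /cons_rule /= !emb_letter catE !shE qsh_word_cons !qsh_word0s.
  + exact: cons_rule0r.
- exact: cons_rule0l.
Qed.

Lemma qsh_emb_CA (diaA : associative dia) (diaC : commutative dia) x y
    (w : words k A) :
  qsh dia c (emb x) (qsh dia c (emb y) w)
  = qsh dia c (emb y) (qsh dia c (emb x) w).
Proof.
elim/words_ind: w => [r w w' IHw IHw'|s].
  exact: sh_CA_linear IHw IHw'.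
elim: s => [|a s IHs].
  rewrite word_nil.
  exact: (sh_CA_one qsh_cons_rule diaC (@mulr1 _) (@qsh1r _ _ dia c) x y).
rewrite -[a :: s]/([:: a] ++ s) -mulr_word -/(letter a) -emb_letter.
exact: sh_CA_cons qsh_cons_rule diaA diaC x y << a >> (word s) IHs.
Qed.

Lemma fps_expE (w : fps (words k A)) :
  fps_exp (qsh dia c) w =1 fps_subst (qsh dia c) 1 (fun i => (i`!%:R)^-1) w.
Proof. by []. Qed.

Lemma fps_inv1BE (w : fps (words k A)) :
  fps_inv1B w =1 fps_subst cat 1 (fun=> 1) w.
Proof. by move=> n; congr (_ + _); apply: eq_bigr => i _; rewrite scale1r. Qed.

Lemma exp_qsh_log (iota : {rmorphism rat -> k})
    (diaA : associative dia) (diaC : commutative dia) (u : fps (letters k A)) :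
    c * c = 1 -> u 0%N = 0 ->
  fps_exp (qsh dia c) (fun n => emb (c *: fps_log dia u n))
  =1 fps_inv1B (fun n => emb (c *: u n)).
Proof.
move=> cc1 u0 n; rewrite fps_expE fps_inv1BE.
apply: (fps_exp_sh (dia := dia) (c := c) (emb := @emb k A) qsh_cons_rule
  (@mulr1 _) (@qsh1r _ _ dia c) iota
  (x := fun n => c *: fps_log dia u n) (v := fun n => c *: u n)).
- by rewrite /fps_log /fps_sum1 big_geq // scaler0.
- by rewrite u0 scaler0.
- by move=> i j w; exact: (qsh_emb_CA diaA diaC).
- by move=> j; exact: (fps_log_scale_ode iota diaA diaC u0 j cc1).
Qed.

End QuasiShuffleAlgebra.

Theorem corollary5p1
  (k : fieldType) (iota : {rmorphism rat -> k}) (A : countType)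
  (dia : {bilinear letters k A -> letters k A -> letters k A})
  (diaA : associative dia) (diaC : commutative dia)
  (z : fps (letters k A)) :
  (fps_exp (qshuffle dia) (fps_emb (fps_log dia (fps_lambda z)))
     =1 fps_inv1B (fps_lambda (fps_emb z)))
  /\
  (fps_exp (qshuffle_star dia)
       (fps_opp (fps_emb (fps_log dia (fps_lambda z))))
     =1 fps_inv1B (fps_opp (fps_lambda (fps_emb z)))).
Proof.
have embS n : emb (fps_lambda z n) = fps_lambda (fps_emb z) n.
  by case: n => [|n] //; rewrite linear0.
(* [erefl] proves that multiples of lambda have no constant coefficient. *)
have main (c : k) (cc1 : c * c = 1) := @exp_qsh_log k A dia c iota diaA diaC
  (fps_lambda z) cc1 erefl.
split=> n.
  transitivity (fps_exp (qsh dia 1)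
      (fun n => emb (1 *: fps_log dia (fps_lambda z) n)) n).
    by rewrite !fps_expE; apply: eq_fps_subst => j; rewrite scale1r.
  rewrite (main 1 (mul1r 1)) !fps_inv1BE.
  by apply: eq_fps_subst => j; rewrite scale1r embS.
have NN1 : (-1) * (-1) = 1 :> k by rewrite mulrNN mul1r.
transitivity (fps_exp (qsh dia (-1))
    (fun n => emb (-1 *: fps_log dia (fps_lambda z) n)) n).
  by rewrite !fps_expE; apply: eq_fps_subst => j; rewrite scaleN1r linearN.
rewrite (main (-1) NN1) !fps_inv1BE.
by apply: eq_fps_subst => j; rewrite scaleN1r linearN /= embS.
Qed.
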